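(* In the setting of the context, put $Z_N=\sqrt N\,i_D^{1/2}(\Psi\theta_N-\Psi_N)$. Assume that, as $N\to\infty$, (a) $\sqrt N\,i_D^{1/2}(\Psi_N-\Psi\theta_0)\to\mathcal N(0,I_k)$ in distribution under $\mathbb P_{\theta_0}$; (b) $\mathcal L(Z_N\mid\mathcal D_N)\to\mathcal N(0,I_k)$ weakly, in $\mathbb P_{\theta_0}$-probability; (c) $\mathbb E[Z_N\mid\mathcal D_N]\to0$ in $\mathbb P_{\theta_0}$-probability; (d) $\mathbb V[Z_N\mid\mathcal D_N]\to I_k$ in $\mathbb P_{\theta_0}$-probability. Then $$\mathcal L\big(\sqrt N\,i_D^{1/2}(\Psi\theta_N-\hat\Psi_N)\mid\mathcal D_N\big)\longrightarrow\mathcal N(0,I_k)\quad\text{weakly, in }\mathbb P_{\theta_0}\text{-probability},$$ and $$\sqrt N\,i_D^{1/2}(\hat\Psi_N-\Psi\theta_0)\longrightarrow\mathcal N(0,I_k)\quad\text{in distribution under }\mathbb P_{\theta_0}.$$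
   Context: Model. $\mathcal X\subset\mathbb R^d$ is a Borel set of positive finite Lebesgue measure with uniform distribution $\lambda_{\mathcal X}$; $\mathbb H$ is a Hilbert space with orthonormal basis $\{e_i\}_{i\in\mathbb N}$; $\Theta$ is a linear subspace of $\mathbb H$ containing $\mathrm{span}\{e_i\}_{i\in\mathbb N}$; $(V,\langle\cdot,\cdot\rangle_V)$ is a finite-dimensional inner product space; $L^2(\mathcal X;V)$ is the space of $V$-valued functions square integrable with respect to $\lambda_{\mathcal X}$; $\mathcal G:\Theta\to L^2(\mathcal X;V)$ is measurable, $\mathcal G_\theta:=\mathcal G(\theta)$. Observations $Y_i=\mathcal G_\theta(X_i)+\varepsilon_i$, with $X_i\sim\lambda_{\mathcal X}$, $\varepsilon_i$ centered Gaussian on $V$ with identity covariance operator, all $X_i,\varepsilon_i$ independent. Fix $\theta_0\in\Theta$; $\mathbb P_{\theta_0}$ is the law of the i.i.d. sequence $(X_i,Y_i)_{i\in\mathbb N}$ under $\theta=\theta_0$; $\varepsilon_i=Y_i-\mathcal G_{\theta_0}(X_i)$ under $\mathbb P_{\theta_0}$; $\mathcal D_N=((X_i,Y_i))_{i\le N}$. Fix linearly independent $\psi_1,\dots,\psi_k\in\mathbb H$ and let $\Psi\theta=(\langle\theta,\psi_i\rangle_{\mathbb H})_{i\le k}\in\mathbb R^k$. Prior and posterior. $E_D=\mathrm{span}\{e_1,\dots,e_D\}$ with $D=D(N)\to\infty$ as $N\to\infty$; $P_{E_D}:\mathbb H\to E_D$ is the orthogonal projection. $\langle\cdot,\cdot\rangle_{\mathcal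 H_N}$ is an inner product on $E_D$ and the prior $\Pi_N$ is the centered Gaussian measure on $(E_D,\langle\cdot,\cdot\rangle_{\mathcal H_N})$ with identity covariance operator. With $\ell_N(\theta)=-\frac12\sum_{i=1}^N\|Y_i-\mathcal G_\theta(X_i)\|_V^2$, the posterior $\Pi_N(\cdot\mid\mathcal D_N)$ is the probability measure on $E_D$ with $\Pi_N$-density proportional to $e^{\ell_N}$. $\mathcal L(f(\theta_N,\mathcal D_N)\mid\mathcal D_N)$, $\mathbb E[f(\theta_N,\mathcal D_N)\mid\mathcal D_N]$, $\mathbb V[f(\theta_N,\mathcal D_N)\mid\mathcal D_N]$ denote the law, mean and (co)variance of $f(\theta_N,\mathcal D_N)$ when $\theta_N\sim\Pi_N(\cdot\mid\mathcal D_N)$. $\hat\Psi_N=\mathbb E[\Psi\theta_N\mid\mathcal D_N]$ is the posterior mean of $\Psi\theta_N$ (it exists). Random laws $\mu_N$ on $\mathbb R^k$ converge weakly to $\mu$ in $\mathbb P_{\theta_0}$-probability if $d_{\mathrm{BL}}(\mu_N,\mu)\to0$ in $\mathbb P_{\theta_0}$-probability, $d_{\mathrm{BL}}$ being the bounded Lipschitz metric. Linearization. Standing assumptions: there is a bounded linear operator $\mathbb I_{\theta_0}:\mathbb H\to L^2(\mathcal X;V)$ such that for every $h\in\Theta$, $\|\mathcal G(\theta_0+\epsilon h)-\mathcal G(\theta_0)-\epsilon\,\mathbb I_{\theta_0}[h]\|_{L^2}=o(\epsilon)$ as $\epsilon\to0$; and, with $\mathcal I=\mathbb I_{\theta_0}^*\mathbb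 I_{\theta_0}$, the operator $\mathcal I_D=P_{E_D}\mathcal I|_{E_D}:E_D\to E_D$ is invertible for all $D\in\mathbb N$. $[\mathcal I_D]\in\mathbb R^{D\times D}$ is the matrix $[\mathcal I_D]_{ij}=\langle\mathcal I_De_i,e_j\rangle_{\mathbb H}$, $\mathcal J_D\in\mathbb R^{k\times D}$ is $(\mathcal J_D)_{ij}=\langle\psi_i,e_j\rangle_{\mathbb H}$, and $$i_D=\big(\mathcal J_D[\mathcal I_D]^{-1}\mathcal J_D^\top\big)^{-1}\in\mathbb R^{k\times k},$$ which is well defined and symmetric positive definite for $D$ large enough. Set $\bar\psi_D^{\,j}=\mathcal I_D^{-1}P_{E_D}\psi_j\in E_D$, $j\le k$, and define $\Psi_N\in\mathbb R^k$ by $$(\Psi_N)_j=(\Psi\theta_0)_j+\frac1N\sum_{i=1}^N\big\langle\varepsilon_i,\mathbb I_{\theta_0}\bar\psi_D^{\,j}(X_i)\big\rangle_V,\quad j\le k.$$ *)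

(* Defs.v *)
From HB Require Import structures.
From mathcomp Require Import all_boot all_order all_algebra.
From mathcomp Require Import finmap sesquilinear.
From mathcomp Require Import all_classical all_reals all_analysis.
Import Order.TTheory GRing.Theory Num.Theory.
Import numFieldNormedType.Exports.

Set Implicit Arguments.
Unset Strict Implicit.
Unset Printing Implicit Defensive.

Local Open Scope classical_set_scope.
Local Open Scope ring_scope.

Notation borel T := (g_sigma_algebraType (@open T)).

(* The topology of [T] is the one given by the inner product; together with
   [completeNormedModType] this says that [T] is a Hilbert space. *)
Definition norm_from_dot (R : realType) (T : normedModType R)
    (dot : {dot T for idfun}) :=
  forall u : T, `|u| ^+ 2 = dot u u.

Definition finite_dimensional (R : realType) (T : normedModType R) :=
  exists (m : nat) (b : 'I_m -> T),
    forall v : T, exists c : 'I_m -> R, v = \sum_i c i *: b i.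

(* An inner product on the subspace [E] only: the values of [ip] outside of [E]
   carry no information. *)
Definition inner_product_on (R : realType) (T : normedModType R) (E : set T)
    (ip : T -> T -> R) :=
  [/\ forall u v, E u -> E v -> ip u v = ip v u,
      forall (a : R) u v w, E u -> E v -> E w ->
        ip (a *: u + v) w = a * ip u w + ip v w &
      forall u, E u -> u != 0 -> 0 < ip u u].

Definition linear_subspace (R : realType) (T : normedModType R) (E : set T) :=
  E 0 /\ forall (a : R) u v, E u -> E v -> E (a *: u + v).

Definition linearly_independent (R : realType) (T : normedModType R) (k : nat)
    (psi : 'I_k -> T) :=
  forall c : 'I_k -> R, \sum_i c i *: psi i = 0 -> forall i, c i = 0.

(* Bases are indexed from 0: [e 0], ..., [e D.-1] stand for e_1, ..., e_D. *)
Definition span_first (R : realType) (T : normedModType R) (e : nat -> T)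
    (D : nat) : set T :=
  [set h | exists c : 'I_D -> R, h = \sum_(i < D) c i *: e i].

Definition orthonormal_basis (R : realType) (T : normedModType R)
    (dot : T -> T -> R) (e : nat -> T) :=
  (forall i j, dot (e i) (e j) = (i == j)%:R) /\
  closure (\bigcup_D span_first e D) = setT.

(* Orthogonal projection onto [span_first e D] when [e] is orthonormal. *)
Definition proj_first (R : realType) (T : normedModType R) (dot : T -> T -> R)
    (e : nat -> T) (D : nat) (h : T) : T :=
  \sum_(i < D) dot h (e i) *: e i.

Definition enorm (R : realType) (k : nat) (x : 'cV[R]_k) : R :=
  Num.sqrt (\sum_i x i 0 ^+ 2).

Definition edot (R : realType) (k : nat) (x y : 'cV[R]_k) : R :=
  \sum_i x i 0 * y i 0.

(* The positive semidefinite square root, [0] if there is none. *)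
Definition mxsqrt (R : realType) (k : nat) (A : 'M[R]_k) : 'M[R]_k :=
  xget 0 [set S : 'M[R]_k | [/\ S^T = S,
    forall x : 'cV[R]_k, 0 <= edot x (S *m x) & S *m S = A]].

(* Measurability with respect to the trace on [D] of the sigma-algebra of [T];
   [D] itself need not be measurable, in which case the library's
   [measurable_fun D] would hold vacuously. *)
Definition trace_measurable d (T : measurableType d) (D A : set T) :=
  exists2 B : set T, measurable B & D `&` A = D `&` B.

(* The Lebesgue measure of R^d is the Borel measure that gives boxes their
   volume. *)
Definition is_lebesgue (R : realType) (d : nat)
    (lam : set (borel 'rV[R]_d) -> \bar R) :=
  forall a b : 'rV[R]_d, (forall i, a 0 i <= b 0 i) ->
    lam [set x : 'rV[R]_d | forall i, a 0 i <= x 0 i <= b 0 i] =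
    (\prod_i (b 0 i - a 0 i))%:E.

Definition is_uniform d (T : measurableType d) (R : realType)
    (lam : set T -> \bar R) (X : set T) (lamX : set T -> \bar R) :=
  forall A : set T, measurable A ->
    lamX A = (((fine (lam X))^-1)%:E * lam (A `&` X))%E.

(* [mu] lives on [E] and is the law of the centered Gaussian vector of
   [(E, ip)] with identity covariance: [ip h] has law N(0, ip h h) for every
   [h] in [E]. The vector [h = 0] is left out because [normal_prob 0 0] is not
   the Dirac mass. *)
Definition std_gaussian_on (R : realType) (T : normedModType R) (E : set T)
    (ip : T -> T -> R) (mu : set (borel T) -> \bar R) :=
  mu E = 1%E /\
  forall h, E h -> h != 0 -> forall B : set R, measurable B ->
    mu (E `&` [set t | B (ip h t)]) = normal_prob 0 (Num.sqrt (ip h h)) B.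

Definition mutually_independent d (Omega : measurableType d) (R : realType)
    (P : set Omega -> \bar R) (I : choiceType) (F : I -> set_system Omega) :=
  forall (J : {fset I}) (A : I -> set Omega),
    (forall i, i \in J -> F i (A i)) ->
    P (\bigcap_(i in [set` J]) A i) = (\prod_(i <- J) P (A i))%E.

Definition joint_sigma d d1 d2 (Omega : measurableType d)
    (T1 : measurableType d1) (T2 : measurableType d2)
    (X : nat -> Omega -> T1) (eps : nat -> Omega -> T2) (s : nat + nat) :
    set_system Omega :=
  match s with
  | inl i => preimage_set_system setT (X i) measurable
  | inr i => preimage_set_system setT (eps i) measurable
  end.

(* Elements of L^2(X; V) are handled through their representatives, functions
   on the whole of R^d of which only the values on [X] matter. *)
Section L2.
Context (R : realType) (d : nat) (V : normedModType R).
Variables (vdot : V -> V -> R) (X : set (borel 'rV[R]_d))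
  (lamX : {measure set (borel 'rV[R]_d) -> \bar R}).
Implicit Types f g : borel 'rV[R]_d -> borel V.

Definition L2 : set (borel 'rV[R]_d -> borel V) :=
  [set f : borel 'rV[R]_d -> borel V | measurable_fun X f /\
           lamX.-integrable X (fun x => (`|f x : V| ^+ 2)%:E)].

Definition L2norm f : R :=
  Num.sqrt (\int[lamX]_(x in X) (`|f x : V| ^+ 2)).

Definition L2dot f g : R := \int[lamX]_(x in X) vdot (f x) (g x).

Definition L2open (U : set (borel 'rV[R]_d -> borel V)) :=
  forall f, L2 f -> U f -> exists2 r : R, 0 < r &
    forall g, L2 g -> L2norm (fun x => (g x : V) - f x) < r -> U g.

Section operators.
Context (H : normedModType R).
Variable hdot : H -> H -> R.

(* Borel sets of L^2 pulled back to the Borel sets of [Theta]; it suffices to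
   pull back the open sets, which generate. *)
Definition L2_measurable (Theta : set H)
    (G : H -> borel 'rV[R]_d -> borel V) :=
  forall U, L2open U ->
    trace_measurable (Theta : set (borel H)) [set t | U (G t)].

(* The likelihood evaluates [G t] pointwise, so the representatives must be
   chosen measurable in [(t, x)]; this is possible whenever [L2_measurable]
   holds. *)
Definition jointly_measurable (Theta : set H)
    (G : H -> borel 'rV[R]_d -> borel V) :=
  forall B : set (borel V), measurable B ->
    @trace_measurable _ (borel H * borel 'rV[R]_d)%type
      (Theta `*` X) [set tx | B (G tx.1 tx.2)].

Definition bounded_linear_L2 (L : H -> borel 'rV[R]_d -> borel V) :=
  [/\ forall h, L2 (L h),
      forall (a : R) (u v : H), {ae lamX, forall x, X x ->
        L (a *: u + v) x = a *: (L u x : V) + L v x} &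
      exists C : R, forall h : H, L2norm (L h) <= C * `|h|].

Definition is_adjoint (L : H -> borel 'rV[R]_d -> borel V)
    (Ladj : (borel 'rV[R]_d -> borel V) -> H) :=
  forall f, L2 f -> forall h : H, hdot (Ladj f) h = L2dot f (L h).

Definition gateaux_linearization (Theta : set H)
    (G : H -> borel 'rV[R]_d -> borel V) (t0 : H)
    (L : H -> borel 'rV[R]_d -> borel V) :=
  forall h : H, Theta h ->
    L2norm (fun x => (G (t0 + s *: h) x : V) - G t0 x - s *: (L h x : V)) / `|s|
      @[s --> (0 : R)^'] --> (0 : R).

End operators.
End L2.

Section truncated_information.
Context (R : realType) (H : normedModType R).
Variables (hdot : H -> H -> R) (e : nat -> H) (info : H -> H).

Definition info_op (D : nat) (h : H) : H := proj_first hdot e D (info h).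

Definition info_mx (D : nat) : 'M[R]_D :=
  \matrix_(i, j) hdot (info_op D (e i)) (e j).

Definition functional_mx (k : nat) (psi : 'I_k -> H) (D : nat) : 'M[R]_(k, D) :=
  \matrix_(i, j) hdot (psi i) (e j).

Definition efficient_info (k : nat) (psi : 'I_k -> H) (D : nat) : 'M[R]_k :=
  let J := functional_mx psi D in
  invmx (J *m invmx (info_mx D) *m J^T).

Definition psi_bar (k : nat) (psi : 'I_k -> H) (D : nat) (j : 'I_k) : H :=
  pinv (span_first e D) (info_op D) (proj_first hdot e D (psi j)).

End truncated_information.

Definition functionals (R : realType) (H : normedModType R)
    (hdot : H -> H -> R) (k : nat) (psi : 'I_k -> H) (t : H) : 'cV[R]_k :=
  \col_i hdot t (psi i).

Section posterior.
Context (R : realType) (d : nat) (V H : normedModType R).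

Definition log_likelihood (G : H -> borel 'rV[R]_d -> borel V) (N : nat)
    (x : nat -> borel 'rV[R]_d) (y : nat -> V) (t : H) : R :=
  - (1 / 2) * \sum_(i < N) `|y i - G t (x i)| ^+ 2.

(* The normalizing integral lies in (0, 1] since [ell <= 0], so that [fine] is
   harmless. *)
Definition is_posterior (E : set H) (prior : set (borel H) -> \bar R)
    (ell : H -> R) (post : set (borel H) -> \bar R) :=
  forall A : set (borel H), measurable A ->
    post A = (((fine (\int[prior]_(t in E) (expR (ell t))%:E))^-1)%:E *
              \int[prior]_(t in A `&` E) (expR (ell t))%:E)%E.

End posterior.

Section convergence.
Context d (Omega : measurableType d) (R : realType).
Variable P : probability Omega R.

(* Convergence in (outer) probability; [mu_ext P] agrees with [P] on measurable
   sets. *)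
Definition cvg_in_probability (W : normedModType R) (X : nat -> Omega -> W)
    (l : W) :=
  forall eps : R, 0 < eps ->
    mu_ext P [set w | eps < `|X N w - l|] @[N --> \oo] --> 0%E.

Definition cvg_in_distribution (k : nat) (X : nat -> Omega -> 'cV[R]_k)
    (nu : probability (borel 'cV[R]_k) R) :=
  forall f : 'cV[R]_k -> R, continuous f -> (exists C, forall x, `|f x| <= C) ->
    ('E_P[(f \o X N)%R] @[N --> \oo] --> 'E_nu[f])%E.

(* Bounded Lipschitz distance, over the functions with both the supremum and
   the Lipschitz constant (for the Euclidean norm) at most 1. *)
Definition dBL (k : nat) (mu nu : set (borel 'cV[R]_k) -> \bar R) : R :=
  sup [set `|fine (\int[mu]_x (f x)%:E) - fine (\int[nu]_x (f x)%:E)| |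
       f in [set f : borel 'cV[R]_k -> R |
             (forall x, `|f x| <= 1) /\
             (forall x y : 'cV[R]_k, `|f x - f y| <= enorm (x - y))]].

Definition weak_cvg_in_probability (k : nat)
    (mu : nat -> Omega -> set (borel 'cV[R]_k) -> \bar R)
    (nu : set (borel 'cV[R]_k) -> \bar R) :=
  cvg_in_probability (fun N w => dBL (mu N w) nu : R^o) 0.

End convergence.

Definition mean_vector d (T : measurableType d) (R : realType)
    (Q : probability T R) (k : nat) (Z : T -> 'cV[R]_k) : 'cV[R]_k :=
  \col_j fine ('E_Q[fun t => Z t j (0 : 'I_1)%R])%E.

Definition covariance_mx d (T : measurableType d) (R : realType)
    (Q : probability T R) (k : nat) (Z : T -> 'cV[R]_k) : 'M[R]_k :=
  \matrix_(i, j) fine (covariance Q (fun t => Z t i 0) (fun t => Z t j 0)).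

(* Main.v *)
Require Import Defs.
From HB Require Import structures.
From mathcomp Require Import all_boot all_order all_algebra.
From mathcomp Require Import finmap sesquilinear.
From mathcomp Require Import all_classical all_reals all_analysis.
Import Order.TTheory GRing.Theory Num.Theory.
From mathcomp Require Import measurable_realfun ring lra.
Import numFieldNormedType.Exports.

(** The posterior of the functionals is centered at [PsiHat] instead of at the
    efficient centering [PsiN]; both conclusions hold because the two centerings
    agree at the scale of interest. Let [m N w] be the posterior mean of
    [Z N w]. As [Z N w] is affine in [Psi t], linearity of the mean gives
    [m N w = rescale N (PsiHat N w - PsiN N w)], and [m N w] tends to [0] in
    probability by hypothesis.

    For the posterior law, [rescale N (Psi t - PsiHat N w) = Z N w t - m N w]:
    the recentered law is a translate of the law of [Z N w], and a translation
    by [m] changes the bounded Lipschitz distance to the Gaussian by at most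
    [Num.sqrt k%:R * `|m|] ([dBL_shift]). For the estimator,
    [rescale N (PsiHat N w - Psi theta0)] is the sum of
    [rescale N (PsiN N w - Psi theta0)] and [m N w], and Slutsky's lemma
    applies ([slutsky]).

    Two points need work. Linearity of the mean requires [Psi] to be integrable
    under the posterior. On the span of the first [D N] basis vectors each
    functional [hdot ^~ (psi j)] is [ip N h] for some [h]
    ([representer_span_first]), so under the prior it is centered normal or
    zero, hence integrable ([gaussian_functional_integrable]). The likelihood is
    at most [1], so the posterior is bounded by a multiple of the prior, and
    integrability passes to it ([posterior_integrable]).

    The other point is that [PsiHat N] enters as a mere map on [Omega], with
    expectations understood as differences of suprema over simple functions.
    Slutsky's lemma is proved for such maps. A Lipschitz test function changes
    by at most a small constant plus a multiple of the indicator of a measurable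
    cover of the bad event ([expectation_lipschitz_le]); these integrals are
    subadditive when one summand is measurable ([integral_le_addr]); and
    Lipschitz functions determine convergence in distribution, by squeezing a
    continuous function between Lipschitz envelopes
    ([cvg_in_distribution_lipschitz]). *)

Set Implicit Arguments.
Unset Strict Implicit.
Unset Printing Implicit Defensive.

Local Open Scope classical_set_scope.
Local Open Scope ring_scope.

Import HBNNSimple.

(** * Integrals of arbitrary nonnegative functions *)

(** The integral of a nonnegative function is a supremum over the simple
    functions below it, which makes it monotone on all functions. *)
Lemma ge0_le_integral_any d (T : measurableType d) (R : realType)
    (mu : {measure set T -> \bar R}) (D : set T) (f g : T -> \bar R) :
  (forall x, D x -> (0 <= f x)%E) -> (forall x, D x -> (f x <= g x)%E) ->
  (\int[mu]_(x in D) f x <= \int[mu]_(x in D) g x)%E.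
Proof.
move=> f0 fg; rewrite !ge0_integralE//; last first.
  by move=> x Dx; exact: le_trans (f0 _ Dx) (fg _ Dx).
apply: le_ereal_sup => _ [h /= hf <-]; exists h => //= x.
apply: le_trans (hf x) _; rewrite /patch; case: ifPn => // /set_mem Dx.
exact: fg.
Qed.

Lemma integral_bounded d (T : measurableType d) (R : realType)
    (P : probability T R) (C : R) (u : T -> R) :
  (forall x, 0 <= u x <= C) -> (0 <= \int[P]_x (u x)%:E <= C%:E)%E.
Proof.
move=> uC; have u0 x : (0 <= (u x)%:E)%E by rewrite lee_fin; case/andP: (uC x).
rewrite integral_ge0//=.
apply: (@le_trans _ _ (\int[P]_x (cst C%:E x))%E).
  by apply: ge0_le_integral_any => // x _; rewrite lee_fin; case/andP: (uC x).
by rewrite integral_cst// [X in (_ * X)%E]probability_setT mule1.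
Qed.

Lemma fin_num_integral_bounded d (T : measurableType d) (R : realType)
    (P : probability T R) (C : R) (u : T -> R) :
  (forall x, 0 <= u x <= C) -> (\int[P]_x (u x)%:E)%E \is a fin_num.
Proof.
move=> /(integral_bounded P)/andP[u0 uC].
by rewrite ge0_fin_numE//; exact: le_lt_trans uC (ltry _).
Qed.

(** If a simple [g] lies below [u + h], then [max (g - h) 0] is measurable and
    lies below [u], so [\int g <= \int u + \int h]. *)
Lemma integral_le_addr d (T : measurableType d) (R : realType)
    (mu : {measure set T -> \bar R}) (u h : T -> R) :
  (forall x, 0 <= u x) -> (forall x, 0 <= h x) -> measurable_fun setT h ->
  (\int[mu]_x (u x + h x)%:E <= \int[mu]_x (u x)%:E + \int[mu]_x (h x)%:E)%E.
Proof.
move=> u0 h0 mh.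
rewrite ge0_integralTE; last by move=> x; rewrite lee_fin addr_ge0.
apply: ge_ereal_sup => _ [g /= gle <-].
have mg : measurable_fun setT (fun x => Num.max (g x - h x) 0).
  by apply: measurable_maxr => //; exact: measurable_funB.
rewrite -integralT_nnsfun.
apply: (@le_trans _ _
    (\int[mu]_x ((Num.max (g x - h x) 0)%:E + (h x)%:E))%E).
  apply: ge0_le_integral_any => x _; rewrite lee_fin //.
  by rewrite -lerBlDr le_max lexx.
rewrite ge0_integralD//; last 4 first.
- by move=> x _; rewrite lee_fin le_max lexx orbT.
- exact/measurable_EFinP.
- by move=> x _; rewrite lee_fin.
- exact/measurable_EFinP.
rewrite leeD2r//; apply: ge0_le_integral_any => x _; rewrite lee_fin.
  by rewrite le_max lexx orbT.
by rewrite ge_max u0 andbT lerBlDr -lee_fin.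
Qed.

Lemma mu_ext_measurable_cover d (T : measurableType d) (R : realType)
    (P : probability T R) (B : set T) (eps : R) : 0 < eps ->
  (mu_ext P B < eps%:E)%E ->
  exists A, [/\ measurable A, B `<=` A & (P A <= eps%:E)%E].
Proof.
move=> eps0 /ereal_inf_lt[_ [F [mF BF] <-] Feps].
exists (\bigcup_n F n); split => //; first exact: bigcupT_measurable.
apply: le_trans (ltW Feps); apply: measure_sigma_subadditive => //.
exact: bigcupT_measurable.
Qed.

(** * Continuous maps and Borel measurability *)

Lemma open_measurable_borel (T : ptopologicalType) (A : set T) :
  open A -> measurable (A : set (borel T)).
Proof. by move=> oA; exact: sub_sigma_algebra. Qed.

Lemma continuous_measurable_real (R : realType) (T : ptopologicalType)
    (f : T -> R) : continuous f -> measurable_fun setT (f : borel T -> R).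
Proof.
move=> /continuousP cf; apply: (measurability _ (RGenOpens.measurableE R)).
move=> _ [_ [a [b ->] <-]]; rewrite setTI; apply: open_measurable_borel.
exact/cf/interval_open.
Qed.

Lemma continuous_measurable_borel (T U : ptopologicalType) (f : T -> U) :
  continuous f -> measurable_fun setT (f : borel T -> borel U).
Proof.
move=> /continuousP cf; 
  apply: (@measurability _ _ (borel T) (borel U) setT f (@open U)) => //.
move=> _ [A oA <-]; rewrite setTI; apply: open_measurable_borel.
exact/cf.
Qed.

Lemma lipschitz_continuous (R : realType) (W : normedModType R) (f : W -> R)
    (M : R) : (forall x y, `|f x - f y| <= M * `|x - y|) -> continuous f.
Proof.
move=> fM x; apply/cvgrPdist_le => e e0.
have M1 : 0 < `|M| + 1 by rewrite ltr_wpDl.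
near=> y.
apply: le_trans (fM _ _) _; apply: (@le_trans _ _ ((`|M| + 1) * `|x - y|)).
  by rewrite ler_wpM2r// (le_trans (ler_norm _))// lerDl.
rewrite -ler_pdivlMl//; near: y; apply: cvgr_dist_le => //.
by rewrite mulr_gt0// invr_gt0.
Unshelve. all: by end_near. Qed.

Lemma continuous_sum (T : topologicalType) (R : realType)
    (W : normedModType R) (I : Type) (r : seq I) (F : I -> T -> W) :
  (forall i, continuous (F i)) -> continuous (fun t => \sum_(i <- r) F i t).
Proof.
move=> cF; elim: r => [|i r IH] t.
  have -> : (fun t => \sum_(i <- [::]) F i t) = cst 0.
    by apply/funext => u; rewrite big_nil.
  exact: cst_continuous.
have -> : (fun t => \sum_(j <- i :: r) F j t) =
    (fun t => F i t + \sum_(j <- r) F j t).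
  by apply/funext => u; rewrite big_cons.
by apply: cvgD; [exact: cF|exact: IH].
Qed.

Lemma mx_norm_ge_entry (R : realType) m n (x : 'M[R]_(m, n)) i j :
  `|x i j| <= `|x|.
Proof.
rewrite [leRHS]/Num.norm/= mx_normrE.
exact: (le_bigmax _ (fun ij : 'I_m * 'I_n => `|x ij.1 ij.2|) (i, j)).
Qed.

Lemma enorm_le (R : realType) k (x : 'cV[R]_k) :
  enorm x <= Num.sqrt k%:R * `|x|.
Proof.
rewrite /enorm -[X in _ * X]normr_id -sqrtr_sqr -sqrtrM// ler_sqrt ?mulr_ge0//.
rewrite -[k in k%:R]card_ord -sumr_const mulr_suml ler_sum// => i _.
rewrite mul1r -[leLHS]real_normK ?num_real// ler_sqr ?nnegrE//.
exact: mx_norm_ge_entry.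
Qed.

Lemma continuous_mx (T : topologicalType) (R : realType) m n
    (F : T -> 'M[R]_(m, n)) :
  (forall i j, continuous (fun t => F t i j)) -> continuous F.
Proof.
move=> cF t; apply/cvgrPdist_le => e e0.
have : \forall u \near t, forall i j, `|F t i j - F u i j| <= e.
  apply: filter_forall => i; apply: filter_forall => j.
  by have /cvgrPdist_le := cF i j t; exact.
apply: filterS => u Fu; rewrite [leLHS]/Num.norm/= mx_normrE.
by apply: bigmax_le => [|ij _]; [exact: ltW|rewrite !mxE].
Qed.

(** * Lipschitz envelopes and Slutsky's lemma *)

Section lip_env.
Context (R : realType) (W : normedModType R).

(** The largest [n]-Lipschitz minorant of [f], that is, its inf-convolution
    with [n * `|_|]. *)
Definition lip_env (f : W -> R) (n : nat) (x : W) : R :=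
  inf [set f y + n%:R * `|x - y| | y in setT].

Variables (f : W -> R) (C : R).
Hypothesis fC : forall x, 0 <= f x <= C.
Implicit Types (n : nat) (x y : W).

Let lb0 n x : lbound [set f y + n%:R * `|x - y| | y in setT] 0.
Proof.
by move=> _ [y _ <-]; rewrite addr_ge0 ?mulr_ge0//; case/andP: (fC y).
Qed.

Lemma lip_env_ge n x (m : R) :
  (forall y, m <= f y + n%:R * `|x - y|) -> m <= lip_env f n x.
Proof.
by move=> mf; apply: lb_le_inf; [exists (f x + n%:R * `|x - x|), x|
  move=> _ [y _ <-]].
Qed.

Lemma lip_env_leD n x y : lip_env f n x <= f y + n%:R * `|x - y|.
Proof. by apply: ge_inf; [exists 0; exact: lb0|exists y]. Qed.

Lemma lip_env_le n x : lip_env f n x <= f x.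
Proof. by have := lip_env_leD n x x; rewrite subrr normr0 mulr0 addr0. Qed.

Lemma lip_env_itv n x : 0 <= lip_env f n x <= C.
Proof.
apply/andP; split; last first.
  by apply: le_trans (lip_env_le _ _) _; case/andP: (fC x).
by apply: lip_env_ge => y; rewrite addr_ge0 ?mulr_ge0//; case/andP: (fC y).
Qed.

Lemma lip_env_lipschitz n x y :
  `|lip_env f n x - lip_env f n y| <= n%:R * `|x - y|.
Proof.
have H u v : lip_env f n u - n%:R * `|u - v| <= lip_env f n v.
  apply: lip_env_ge => z; rewrite lerBlDr.
  apply: le_trans (lip_env_leD n u z) _; rewrite -addrA lerD2l -mulrDr.
  by rewrite ler_wpM2l// [leRHS]addrC ler_distD.
have := H x y; have := H y x; rewrite (distrC y x) ler_norml => h1 h2.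
by apply/andP; split; lra.
Qed.

(** Points close to [x] contribute at least [f x - e] by continuity; the others,
    at distance at least [r], contribute at least [n * r >= C >= f x]. *)
Lemma cvg_lip_env x : {for x, continuous f} ->
  lip_env f n x @[n --> \oo] --> f x.
Proof.
move=> /cvgrPdist_le cf; apply/cvgrPdist_le => e e0.
have /nbhs_normP[r /= r0 rf] := cf _ e0.
have [n0 n0C] : exists n0 : nat, C / r <= n0%:R.
  by exists (Num.trunc (C / r)).+1; rewrite ltW// truncnS_gt.
exists n0 => // n /= n0n.
rewrite ger0_norm ?subr_ge0 ?lip_env_le// lerBlDr -lerBlDl.
apply: lip_env_ge => y; have [xy|xy] := ltP `|x - y| r.
  have := rf y xy; rewrite ler_norml => /andP[_ h].
  have : 0 <= n%:R * `|x - y| by rewrite mulr_ge0.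
  by lra.
have C0 : 0 <= C by have /andP[/le_trans] := fC 0; exact.
have : C <= n%:R * `|x - y|.
  rewrite -[C](@divfK _ r) ?gt_eqF// ler_pM ?divr_ge0 ?(ltW r0)//.
  by apply: le_trans n0C _; rewrite ler_nat.
have /andP[h1 _] := fC y; have /andP[_ h2] := fC x; lra.
Qed.

End lip_env.

Section portmanteau.
Context d (Omega : measurableType d) (R : realType) (P : probability Omega R).
Variables (k : nat) (nu : probability (borel 'cV[R]_k) R).
Variable Y : nat -> Omega -> 'cV[R]_k.

Hypothesis cvg_lipschitz : forall (g : 'cV[R]_k -> R) (M C : R),
  (forall x, 0 <= g x <= C) -> 0 <= M ->
  (forall x y, `|g x - g y| <= M * `|x - y|) ->
  \int[P]_w g (Y N w) @[N --> \oo] --> \int[nu]_x g x.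

Let cvg_lip_env_integral (f : 'cV[R]_k -> R) (C : R) :
  continuous f -> (forall x, 0 <= f x <= C) ->
  \int[nu]_x lip_env f n x @[n --> \oo] --> \int[nu]_x f x.
Proof.
move=> cf fC.
have cg n : continuous (lip_env f n).
  apply: (@lipschitz_continuous _ _ _ n%:R) => x y.
  exact: lip_env_lipschitz fC _ _ _.
have nf := @fin_num_integral_bounded _ (borel 'cV[R]_k) R nu C f fC.
apply: fine_cvg; rewrite fineK//.
apply: (@dominated_cvg _ _ _ nu setT measurableT _ _ (cst C%:E)) => //.
- move=> n; apply/measurable_EFinP.
  exact: (continuous_measurable_real (cg n)).
- move=> x _; apply/fine_cvgP; split; first exact: nearW.
  exact: cvg_lip_env fC _ (cf x).
- exact: finite_measure_integrable_cst.
- move=> n x _; rewrite lee_fin ger0_norm; by case/andP: (lip_env_itv fC n x).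
Qed.

Let cvg_ge0 (f : 'cV[R]_k -> R) (C : R) :
  continuous f -> (forall x, 0 <= f x <= C) ->
  \int[P]_w f (Y N w) @[N --> \oo] --> \int[nu]_x f x.
Proof.
move=> cf fC; apply/cvgrPdist_le => e e0.
have e2 : 0 < e / 2 by rewrite divr_gt0.
pose f' x := C - f x.
have cf' : continuous f'.
  by move=> x; apply: continuousB; [exact: cst_continuous|exact: cf].
have f'C x : 0 <= f' x <= C.
  by have /andP[h1 h2] := fC x; apply/andP; split; rewrite /f'; lra.
have le_fine (u v : Omega -> R) : (forall w, 0 <= u w <= C) ->
    (forall w, 0 <= v w <= C) -> (forall w, u w <= v w) ->
    \int[P]_w u w <= \int[P]_w v w.
  move=> uC vC uv; apply: fine_le;
    [exact: fin_num_integral_bounded uC|exact: fin_num_integral_bounded vC|].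
  by apply: ge0_le_integral_any => w _; rewrite lee_fin//; case/andP: (uC w).
have nu_compl (u : 'cV[R]_k -> R) : continuous u -> (forall x, 0 <= u x <= C) ->
    \int[nu]_x (C - u x) = C - \int[nu]_x u x.
  move=> cu uC; rewrite RintegralB//; last 2 first.
  - exact: finite_measure_integrable_cst.
  - apply: measurable_bounded_integrable => //.
    + by rewrite [X in (X < _)%E]probability_setT ltry.
    + exact: continuous_measurable_real.
    + exists C; split; first exact: num_real.
      move=> z Cz x _ /=; rewrite ger0_norm; last by case/andP: (uC x).
      by apply: le_trans (ltW Cz); case/andP: (uC x).
  by rewrite Rintegral_cst// [X in fine X]probability_setT mulr1.
have /cvgrPdist_le/(_ _ e2)[m _] := cvg_lip_env_integral cf fC.
move=> /(_ m (leqnn m))/= hm.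
have /cvgrPdist_le/(_ _ e2)[m' _] := cvg_lip_env_integral cf' f'C.
move=> /(_ m' (leqnn m'))/= hm'.
(* [g <= f <= g'], and both Lipschitz functions have almost the same integral
   as [f] under the limit law *)
pose g := lip_env f m; pose g' x := C - lip_env f' m' x.
have gC x : 0 <= g x <= C by exact: lip_env_itv fC _ _.
have g'C x : 0 <= g' x <= C.
  have /andP[h1 h2] := lip_env_itv f'C m' x.
  by apply/andP; split; rewrite /g'; lra.
have gL x y : `|g x - g y| <= m%:R * `|x - y|.
  exact: lip_env_lipschitz fC _ _ _.
have g'L x y : `|g' x - g' y| <= m'%:R * `|x - y|.
  rewrite /g' opprB addrC addrA subrK distrC.
  exact: lip_env_lipschitz f'C _ _ _.
have := cvg_lipschitz gC (ler0n _ _) gL => /cvgrPdist_le/(_ _ e2) hg.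
have := cvg_lipschitz g'C (ler0n _ _) g'L => /cvgrPdist_le/(_ _ e2) hg'.
have cg' : continuous (lip_env f' m').
  apply: (@lipschitz_continuous _ _ _ m'%:R) => x y.
  exact: lip_env_lipschitz f'C _ _ _.
near=> N.
have h1 : `|\int[nu]_x g x - \int[P]_w g (Y N w)| <= e / 2 by near: N.
have h2 : `|\int[nu]_x g' x - \int[P]_w g' (Y N w)| <= e / 2 by near: N.
have l1 : \int[P]_w g (Y N w) <= \int[P]_w f (Y N w).
  by apply: le_fine => // w; exact: lip_env_le fC _ _.
have l2 : \int[P]_w f (Y N w) <= \int[P]_w g' (Y N w).
  apply: le_fine => // w; rewrite /g' lerBrDl -lerBrDr.
  exact: lip_env_le f'C _ _.
rewrite nu_compl// in hm'; rewrite /g' nu_compl// in h2; last first.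
  by move=> x; exact: lip_env_itv f'C _ _.
move: hm hm' h1 h2; rewrite !ler_norml.
move=> /andP[? ?] /andP[? ?] /andP[? ?] /andP[? ?].
by apply/andP; split; rewrite -/g in l1 *; lra.
Unshelve. all: by end_near. Qed.

(** Nonnegative bounded continuous [f] are squeezed between the Lipschitz
    functions [lip_env f n] and [C - lip_env (C - f) n], whose integrals under
    [nu] tend to that of [f] by dominated convergence. The general case follows
    because an integral is by definition the difference of the integrals of the
    positive and negative parts. *)
Lemma cvg_in_distribution_lipschitz : cvg_in_distribution P Y nu.
Proof.
move=> f cf [C fC].
pose fp x := Num.max (f x) 0; pose fn x := Num.max (- f x) 0.
have cfp : continuous fp.
  move=> x; apply: (@continuous_max R _ f (cst 0) x); [exact: cf|].
  exact: cst_continuous.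
have cfn : continuous fn.
  move=> x; apply: (@continuous_max R _ (\- f) (cst 0) x).
    by apply: continuousN; exact: cf.
  exact: cst_continuous.
have C0 : 0 <= C by exact: le_trans (fC 0).
have fpC x : 0 <= fp x <= C.
  by rewrite le_max lexx orbT ge_max C0 andbT (le_trans (ler_norm _) (fC x)).
have fnC x : 0 <= fn x <= C.
  rewrite le_max lexx orbT ge_max C0 andbT.
  by rewrite (le_trans _ (fC x))// -normrN ler_norm.
have E d' (T : measurableType d') (mu : probability T R) (u : T -> 'cV[R]_k) :
    'E_mu[(f \o u)%R]%E = (\int[mu]_w fp (u w) - \int[mu]_w fn (u w))%:E.
  have fpf := @fin_num_integral_bounded _ T R mu C (fp \o u)
    (fun w => fpC (u w)).
  have fnf := @fin_num_integral_bounded _ T R mu C (fn \o u)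
    (fun w => fnC (u w)).
  rewrite unlock integralE EFinB /Rintegral !fineK//.
  congr (_ - _)%E; apply: eq_integral => w _;
    by rewrite ?funeposE ?funenegE /= EFin_max ?EFinN.
have -> : (fun N => 'E_P[(f \o Y N)%R]%E) =
    (fun N => (\int[P]_w fp (Y N w) - \int[P]_w fn (Y N w))%:E).
  by apply/funext => N; exact: E.
rewrite -[f]/(f \o idfun) E; apply: cvg_EFin; first exact: nearW.
by apply: cvgB; [exact: cvg_ge0 cfp fpC|exact: cvg_ge0 cfn fnC].
Qed.

End portmanteau.

(** The set where [X N] and [Y N] are more than [del] apart is covered by a
    measurable [A] of small probability. Off [A] the Lipschitz bound gives
    [g (X N) <= g (Y N) + M * del]; on [A] the bound is [C]. So the measurable
    function [eps / 2 + C * \1_A] dominates the difference everywhere. *)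
Lemma expectation_lipschitz_le d (Omega : measurableType d) (R : realType)
    (P : probability Omega R) (k : nat) (X Y : nat -> Omega -> 'cV[R]_k)
    (g : 'cV[R]_k -> R) (M C eps : R) :
  cvg_in_probability P (fun N w => Y N w - X N w) 0 ->
  (forall x, 0 <= g x <= C) ->
  0 <= M -> (forall x y, `|g x - g y| <= M * `|x - y|) -> 0 < eps ->
  \forall N \near \oo,
    (\int[P]_w (g (X N w))%:E <= \int[P]_w (g (Y N w))%:E + eps%:E)%E.
Proof.
move=> XY gC M0 gM eps0.
have C0 : 0 <= C by have /andP[/le_trans] := gC 0; exact.
have M1 : 0 < M + 1 by rewrite ltr_wpDl.
have C1 : 0 < C + 1 by rewrite ltr_wpDl.
pose del := eps / 2 / (M + 1); pose eta := eps / 2 / (C + 1).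
have del0 : 0 < del by rewrite !divr_gt0.
have eta0 : 0 < eta by rewrite !divr_gt0.
have /= := XY _ del0; move/(_ [set x | (x < eta%:E)%E]) => /(_ _)[].
  apply: open_nbhs_nbhs; split; first exact: open_ereal_lt_ereal.
  by rewrite /= lte_fin.
move=> N0 _ HN0; exists N0 => // N /HN0/=.
move=> /(mu_ext_measurable_cover eta0)[A [mA BA PA]].
pose h w := eps / 2 + C * \1_A w.
have h0 w : 0 <= h w by rewrite addr_ge0 ?mulr_ge0// ltW ?divr_gt0.
have mh : measurable_fun setT h.
  by apply: measurable_funD => //; apply: measurable_funM.
apply: (@le_trans _ _ (\int[P]_w (g (Y N w) + h w)%:E)%E).
  apply: ge0_le_integral_any => w _; rewrite lee_fin.
    by case/andP: (gC (X N w)).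
  have [Aw|Aw] := pselect (A w).
    rewrite /h indicE mem_set// mulr1.
    have /andP[_ ?] := gC (X N w); have /andP[? _] := gC (Y N w).
    by rewrite -[leLHS]add0r lerD// -[leLHS]add0r lerD// ltW ?divr_gt0.
  rewrite /h indicE memNset// mulr0 addr0 -lerBlDl.
  apply: le_trans (ler_norm _) _; apply: le_trans (gM _ _) _.
  have Bw : `|X N w - Y N w| <= del.
    by rewrite leNgt distrC -[Y N w - _]subr0; apply/negP => /BA.
  apply: le_trans (ler_wpM2l M0 Bw) _.
  rewrite /del mulrCA ler_piMr ?divr_ge0 ?ltW//.
  by rewrite ltr_pdivrMr// mul1r ltrDl.
apply: le_trans (integral_le_addr _ _ h0 mh) _.
  by move=> w; case/andP: (gC (Y N w)).
rewrite leeD2l//; under eq_integral do rewrite EFinD [X in (_ + X)%E]EFinM.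
have m1 : measurable_fun setT (fun w => (\1_A w)%:E : \bar R).
  exact/measurable_EFinP.
rewrite ge0_integralD//; last 3 first.
- by move=> w _; rewrite lee_fin ltW ?divr_gt0.
- by move=> w _; rewrite -EFinM lee_fin mulr_ge0.
- exact: emeasurable_funM.
rewrite integral_cst// [X in (_ * X + _)%E]probability_setT mule1.
rewrite ge0_integralZl//.
rewrite integral_indic// setIT [leRHS](_ : _ = (eps / 2)%:E + (eps / 2)%:E)%E.
  rewrite leeD2l//; apply: le_trans (lee_wpmul2l _ PA) _; rewrite ?lee_fin//.
  by rewrite /eta mulrCA ler_piMr ?divr_ge0 ?ltW// ltr_pdivrMr// mul1r ltrDl.
by rewrite -EFinD -splitr.
Qed.

(** Slutsky's theorem. [X N] and [Y N] are arbitrary maps: expectations are then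
    lower integrals and convergence in probability uses the outer measure. *)
Lemma slutsky d (Omega : measurableType d) (R : realType)
    (P : probability Omega R) (k : nat) (nu : probability (borel 'cV[R]_k) R)
    (X Y : nat -> Omega -> 'cV[R]_k) :
  cvg_in_distribution P X nu ->
  cvg_in_probability P (fun N w => Y N w - X N w) 0 ->
  cvg_in_distribution P Y nu.
Proof.
move=> Xnu XY; apply: cvg_in_distribution_lipschitz => g M C gC M0 gM.
have YX : cvg_in_probability P (fun N w => X N w - Y N w) 0.
  move=> e e0.
  under eq_fun do under eq_set do rewrite subr0 distrC -[_ - _]subr0.
  exact: XY.
have gb : exists C, forall x, `|g x| <= C.
  by exists C => x; rewrite ger0_norm; case/andP: (gC x).
have fing (u : Omega -> 'cV[R]_k) :=
  @fin_num_integral_bounded _ _ _ P C (g \o u) (fun w => gC (u w)).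
have := Xnu g (lipschitz_continuous gM) gb.
rewrite unlock -[X in _ --> X]fineK; last first.
  exact: (@fin_num_integral_bounded _ _ _ nu C g gC).
move=> /fine_cvg/cvgrPdist_le Xg; apply/cvgrPdist_le => e e0.
have e2 : 0 < e / 2 by rewrite divr_gt0.
have h1 := expectation_lipschitz_le XY gC M0 gM e2.
have h2 := expectation_lipschitz_le YX gC M0 gM e2.
near=> N.
have h3 : `|\int[nu]_x g x - \int[P]_w g (X N w)| <= e / 2.
  by near: N; exact: Xg.
have h4 : \int[P]_w g (X N w) <= \int[P]_w g (Y N w) + e / 2.
  by rewrite -lee_fin EFinD /Rintegral !fineK ?fing//; near: N; exact: h1.
have h5 : \int[P]_w g (Y N w) <= \int[P]_w g (X N w) + e / 2.
  by rewrite -lee_fin EFinD /Rintegral !fineK ?fing//; near: N; exact: h2.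
by move: h3; rewrite !ler_norml => /andP[? ?]; apply/andP; split; lra.
Unshelve. all: by end_near. Qed.

Lemma cvg_in_probability_le d (Omega : measurableType d) (R : realType)
    (P : probability Omega R) (W : normedModType R) (U A : nat -> Omega -> R^o)
    (B : nat -> Omega -> W) (c : R) :
  0 <= c -> (forall N w, 0 <= U N w <= A N w + c * `|B N w|) ->
  cvg_in_probability P A 0 -> cvg_in_probability P B 0 ->
  cvg_in_probability P U 0.
Proof.
move=> c0 UAB cA cB e e0.
have c1 : 0 < c + 1 by rewrite ltr_wpDl.
have e2 : 0 < e / 2 by rewrite divr_gt0.
have e3 : 0 < e / 2 / (c + 1) by rewrite divr_gt0.
have := cvgeD _ (cA _ e2) (cB _ e3); rewrite adde0 => /(_ _ isT) H.
apply: (squeeze_cvge _ (cvg_cst 0%E) H); apply: nearW => N.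
apply/andP; split; first exact: mu_ext_ge0.
apply: le_trans (outer_measureU2 (mu_ext P) _ _).
apply: le_mu_ext => w /=; rewrite !subr0.
have /andP[U0 UN] := UAB N w; rewrite ger0_norm// => eU.
have [h|h] := ltP (e / 2) `|A N w|; [by left|right].
rewrite ltNge; apply/negP => h'.
have : c * `|B N w| <= e / 2.
  apply: le_trans (ler_wpM2l c0 h') _.
  by rewrite mulrCA ler_piMr ?ltW// ltr_pdivrMr// mul1r ltrDl.
by have := ler_norm (A N w); lra.
Qed.

(** * Bounded Lipschitz distance and translations *)

Section bounded_lipschitz.
Context d (T : measurableType d) (R : realType) (k : nat).
Implicit Types (Z : T -> borel 'cV[R]_k) (f : borel 'cV[R]_k -> R).

(** The test functions over which [dBL] takes its supremum. *)
Definition BL1 : set (borel 'cV[R]_k -> R) :=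
  [set f | (forall x, `|f x| <= 1) /\
           (forall x y : 'cV[R]_k, `|f x - f y| <= enorm (x - y))].

Lemma BL1_0 : BL1 (cst 0).
Proof. by split => [x|x y]; rewrite /= ?subr0 normr0// sqrtr_ge0. Qed.

Lemma BL1_measurable f : BL1 f -> measurable_fun setT f.
Proof.
move=> [_ fL]; apply: continuous_measurable_real.
apply: (@lipschitz_continuous _ _ _ (Num.sqrt k%:R)) => x y.
exact: le_trans (fL _ _) (enorm_le _).
Qed.

Variable mu : probability T R.

Lemma BL1_integrable f Z : measurable_fun setT Z -> BL1 f ->
  mu.-integrable setT (EFin \o (f \o Z)).
Proof.
move=> mZ BLf; apply: measurable_bounded_integrable => //.
- by rewrite [X in (X < _)%E]probability_setT ltry.
- by apply: measurableT_comp => //; exact: BL1_measurable.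
- exists 1; split; first exact: num_real.
  by move=> z z1 x _ /=; apply: le_trans (ltW z1); exact: BLf.1.
Qed.

Lemma BL1_integral_pushforward f Z : measurable_fun setT Z -> BL1 f ->
  fine (\int[pushforward mu Z]_x (f x)%:E) = \int[mu]_t f (Z t).
Proof.
move=> mZ BLf; rewrite integral_pushforward//.
  by apply/measurable_EFinP; exact: BL1_measurable.
exact: BL1_integrable.
Qed.

Lemma BL1_integral_le1 f Z : measurable_fun setT Z -> BL1 f ->
  `|\int[mu]_t f (Z t)| <= 1.
Proof.
move=> mZ BLf.
apply: le_trans (le_normr_Rintegral measurableT (BL1_integrable mZ BLf)) _.
apply: (@le_trans _ _ (\int[mu]_t 1)).
  apply: le_Rintegral => //.
  - exact: integrable_norm (BL1_integrable mZ BLf).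
  - exact: finite_measure_integrable_cst.
  - by move=> t _; exact: BLf.1.
by rewrite Rintegral_cst// [X in fine X]probability_setT mulr1.
Qed.

End bounded_lipschitz.

Section dBL_shift.
Context d (T : measurableType d) (R : realType) (k : nat).
Variables (mu : probability T R) (nu : probability (borel 'cV[R]_k) R).
Variables (Z : T -> borel 'cV[R]_k) (mZ : measurable_fun setT Z).

Lemma BL1_le_dBL f : BL1 f ->
  `|\int[mu]_t f (Z t) - \int[nu]_x f x| <= dBL (pushforward mu Z) nu.
Proof.
move=> BLf; apply: ub_le_sup; last first.
  by exists f => //; rewrite BL1_integral_pushforward.
(* the supremum is finite: two integrals of functions bounded by 1 *)
exists 2 => _ [g BLg <-]; rewrite BL1_integral_pushforward//.
apply: le_trans (ler_normB _ _) _; rewrite -[2]/(1 + 1) lerD//.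
  exact: BL1_integral_le1.
exact: (@BL1_integral_le1 _ _ _ _ nu g id).
Qed.

Lemma dBL_ge0 : 0 <= dBL (pushforward mu Z) nu.
Proof.
exact: le_trans (BL1_le_dBL (@BL1_0 _ _)).
Qed.

Lemma dBL_ubound (mu' : set (borel 'cV[R]_k) -> \bar R) (c : R) :
  (forall f, BL1 f ->
    `|fine (\int[mu']_x (f x)%:E) - \int[nu]_x f x| <= c) -> dBL mu' nu <= c.
Proof.
move=> h; apply: ge_sup => [|_ [f BLf <-]]; last exact: h.
by eexists; exists (cst 0) => //; exact: BL1_0.
Qed.

(** Translating the argument by [m] moves a test function by at most the
    Euclidean norm of [m]. *)
Lemma dBL_shift (m : 'cV[R]_k) :
  measurable_fun setT (fun t => (Z t : 'cV[R]_k) - m : borel 'cV[R]_k) ->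
  dBL (pushforward mu (fun t => (Z t : 'cV[R]_k) - m : borel 'cV[R]_k)) nu <=
  dBL (pushforward mu Z) nu + Num.sqrt k%:R * `|m|.
Proof.
move=> mZm; apply: dBL_ubound => f BLf; rewrite BL1_integral_pushforward//.
apply: le_trans (ler_distD (\int[mu]_t f (Z t)) _ _) _.
rewrite addrC lerD ?BL1_le_dBL//.
rewrite -RintegralB//; [|exact: BL1_integrable..].
have intB : mu.-integrable setT
    (EFin \o (fun t => f ((Z t : 'cV[R]_k) - m) - f (Z t))).
  apply: (eq_integrable measurableT (fun t =>
      (f ((Z t : 'cV[R]_k) - m))%:E - (f (Z t))%:E)%E) => //.
  by apply: integrableB => //; exact: BL1_integrable.
apply: le_trans (le_normr_Rintegral measurableT intB) _.
apply: (@le_trans _ _ (\int[mu]_t (Num.sqrt k%:R * `|m|))).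
  apply: le_Rintegral => //.
  - exact: integrable_norm intB.
  - exact: finite_measure_integrable_cst.
  - move=> t _; apply: le_trans (BLf.2 _ _) _.
    rewrite addrAC subrr sub0r -(normrN m).
    exact: enorm_le.
by rewrite Rintegral_cst// [X in fine X]probability_setT mulr1.
Qed.

End dBL_shift.

(** * Absolute moments of normal laws *)

Lemma le_integral_density d (T : measurableType d) (R : realType)
    (mu nu : {measure set T -> \bar R}) (p f : T -> R) :
  (forall x, 0 <= p x) -> measurable_fun setT p ->
  (forall A, measurable A -> nu A = (\int[mu]_(x in A) (p x)%:E)%E) ->
  (forall x, 0 <= f x) ->
  (\int[nu]_x (f x)%:E <= \int[mu]_x (f x * p x)%:E)%E.
Proof.
move=> p0 mp nuE f0; rewrite ge0_integralTE; last by move=> x; rewrite lee_fin.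
apply: ge_ereal_sup => _ [h /= hf <-].
(* for simple functions the change of measure is an equality *)
rewrite (_ : sintegral nu h = (\int[mu]_x (h x * p x)%:E)%E); last first.
  under eq_integral => x _.
    rewrite fimfunE EFinM -fsumEFin// muleC ge0_mule_fsumr; last first.
      by move=> r; rewrite EFinM nnfun_muleindic_ge0.
    over.
  rewrite ge0_integral_fsum//; last 2 first.
  - move=> r; apply/emeasurable_funM/measurable_EFinP.
      exact/measurable_EFinP.
    exact: measurableT_comp.
  - move=> r x _; apply: mule_ge0; first by rewrite lee_fin.
    by rewrite EFinM nnfun_muleindic_ge0.
  rewrite sintegralE; apply: eq_fsbigr => r /set_mem[y _ <-].
  have mh : measurable (h @^-1` [set h y]) by [].
  rewrite nuE// integral_mkcond -ge0_integralZl//; last 3 first.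
  - apply/(measurable_restrictT _ mh)/measurable_EFinP.
    exact: measurable_funTS.
  - by move=> x _; rewrite patchE; case: ifP => // _; rewrite lee_fin.
  - by rewrite lee_fin.
  apply: eq_integral => x _; rewrite patchE indicE; case: ifP => _.
    by rewrite mulr1 muleC.
  by rewrite mulr0 !mule0.
apply: ge0_le_integral_any => x _; rewrite lee_fin ?mulr_ge0// ler_wpM2r//.
by rewrite -lee_fin.
Qed.

(** [`|x|] times the density of standard deviation [s] is at most a constant
    times the density of standard deviation [s * sqrt 2], because
    [`|x| <= `|s| * (1 + u) <= `|s| * expR u] for [u = x ^+ 2 / (4 s ^+ 2)], and
    half of the Gaussian exponent [- 2 u] pays for [expR u]. *)
Lemma normal_abs_moment_lty (R : realType) (s : R) : s != 0 ->
  (\int[normal_prob 0 s]_x (`|x|)%:E < +oo)%E.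
Proof.
move=> s0.
have s2 : s * Num.sqrt 2 != 0 by rewrite mulf_neq0// gt_eqF// sqrtr_gt0.
pose c := `|s| * (normal_peak s / normal_peak (s * Num.sqrt 2)).
have p2 := normal_peak_gt0 s2; have p1 := normal_peak_gt0 s0.
apply: le_lt_trans (@le_integral_density _ _ _ lebesgue_measure
  (normal_prob 0 s) (normal_pdf 0 s) _ (@normal_pdf_ge0 _ _ _)
  (@measurable_normal_pdf _ _ _) _ _) _ => //.
apply: (@le_lt_trans _ _ (\int[lebesgue_measure]_x
    (c%:E * (normal_pdf 0 (s * Num.sqrt 2) x)%:E))%E).
  apply: ge0_le_integral_any => x _; rewrite -?EFinM lee_fin.
    by rewrite mulr_ge0 ?normal_pdf_ge0.
  rewrite !normal_pdfE// /normal_fun subr0.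
  set u := x ^+ 2 / (s ^+ 2 *+ 2 *+ 2).
  have -> : - x ^+ 2 / (s ^+ 2 *+ 2) = - u - u.
    by rewrite /u; field.
  have -> : - x ^+ 2 / ((s * Num.sqrt 2) ^+ 2 *+ 2) = - u.
    by rewrite exprMn sqr_sqrtr// mulr_natr mulNr.
  rewrite expRD mulrCA.
  have -> : c * (normal_peak (s * Num.sqrt 2) * expR (- u)) =
      normal_peak s * (`|s| * expR (- u)).
    by rewrite /c; field; rewrite gt_eqF.
  rewrite ler_wpM2l ?normal_peak_ge0// mulrA ler_wpM2r ?expR_ge0//.
  rewrite expRN ler_pdivrMr ?expR_gt0//.
  apply: (@le_trans _ _ (`|s| * (1 + u))); last first.
    by rewrite ler_wpM2l// expR_ge1Dx.
  have sn : `|s| != 0 by rewrite normr_eq0.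
  rewrite -[leLHS](divfK sn) mulrC ler_wpM2l//.
  have -> : u = (`|x| / `|s|) ^+ 2 / 4.
    rewrite /u -[x ^+ 2]real_normK ?num_real// -[s ^+ 2]real_normK ?num_real//.
    by field.
  by have := sqr_ge0 (`|x| / `|s| / 2 - 1); lra.
rewrite ge0_integralZl//.
- by rewrite integral_normal_pdf mule1 ltry.
- by apply/measurable_EFinP; exact: measurable_normal_pdf.
- by move=> x _; rewrite lee_fin normal_pdf_ge0.
- by rewrite lee_fin mulr_ge0// divr_ge0 ?normal_peak_ge0.
Qed.

Lemma normal_law_abs_moment_lty d (T : measurableType d) (R : realType)
    (mu : probability T R) (X : T -> R) (s : R) :
  s != 0 -> measurable_fun setT X ->
  (forall B : set R, measurable B -> mu (X @^-1` B) = normal_prob 0 s B) ->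
  (\int[mu]_t (`|X t|)%:E < +oo)%E.
Proof.
move=> s0 mX lawX.
have mXR : measurable_fun setT (X : T -> measurableTypeR R) := mX.
pose mX_mixin := isMeasurableFun.Build _ _ _ _ _ mXR.
pose Y : {mfun T >-> measurableTypeR R} := HB.pack X mX_mixin.
rewrite -[ltLHS]/(\int[mu]_t
  ((fun x : measurableTypeR R => (`|x|)%:E) \o Y) t)%E.
rewrite -(@ge0_integral_distribution _ _ T _ R mu Y (fun x => `|x|%:E));
  last 2 first.
- by apply/measurable_EFinP; exact: normr_measurable.
- by move=> x; rewrite lee_fin.
rewrite (@eq_measure_integral _ (measurableTypeR R) R setT (normal_prob 0 s)
  (distribution mu Y)).
  exact: normal_abs_moment_lty.
by move=> B mB _; exact: lawX.
Qed.

(** * Linear functionals on the span of the first basis vectors *)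

Section dot.
Context (R : realType) (H : normedModType R) (hdot : {dot H for idfun}).
Hypothesis hdot_norm : norm_from_dot hdot.

Lemma dotC u v : hdot u v = hdot v u.
Proof. by rewrite hermC expr0 mul1r. Qed.

(** By polarization, an inner product is a polynomial in norms. *)
Lemma dot_continuous v : continuous (hdot ^~ v).
Proof.
have -> : hdot ^~ v = fun u => (`|u + v| ^+ 2 - `|u| ^+ 2 - `|v| ^+ 2) / 2.
  apply/funext => u; rewrite !hdot_norm [hdot (u + v) _]linearDl/=.
  rewrite [hdot u (u + v)]linearDr/= [hdot v (u + v)]linearDr/= (dotC v u).
  by field.
move=> u; apply: cvgM; last exact: cvg_cst.
apply: cvgB; last exact: cvg_cst.
have nc (w : H) : (`|u' + w| ^+ 2) @[u' --> u] --> `|u + w| ^+ 2.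
  apply: cvgM; apply: cvg_norm; apply: cvgD => //; exact: cvg_cst.
apply: cvgB; first exact: nc.
by have := nc 0; under eq_cvg do rewrite addr0; rewrite addr0.
Qed.

Variable e : nat -> H.
Hypothesis e_on : forall i j, hdot (e i) (e j) = (i == j)%:R.
Variable D : nat.

Lemma span_first_e (i : 'I_D) : span_first e D (e i).
Proof.
exists (fun j => (j == i)%:R); rewrite (bigD1 i)//= eqxx scale1r big1 ?addr0//.
by move=> j /negbTE ->; rewrite scale0r.
Qed.

Lemma dot_sum_first (c : 'I_D -> R) (j : 'I_D) :
  hdot (\sum_(i < D) c i *: e i) (e j) = c j.
Proof.
rewrite linear_sumlz/= (bigD1 j)//= big1 ?addr0; last first.
  move=> i ij; rewrite linearZl_LR/= e_on.
  by rewrite -(inj_eq val_inj) in ij; rewrite (negbTE ij) mulr0.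
by rewrite linearZl_LR/= e_on eqxx mulr1.
Qed.

Lemma span_firstE : span_first e D = [set t | proj_first hdot e D t = t].
Proof.
apply/seteqP; split => [_ [c ->]|t /= tE] /=; last first.
  by exists (fun i => hdot t (e i)); exact: esym tE.
by apply: eq_bigr => i _; rewrite dot_sum_first.
Qed.

(** The span is the zero set of the continuous function
    [t |-> `|proj t - t|]. *)
Lemma measurable_span_first : measurable (span_first e D : set (borel H)).
Proof.
have cf : continuous (fun t : H => `|proj_first hdot e D t - t|).
  move=> t; apply: cvg_norm; apply: cvgB => //; apply: continuous_sum => i u.
  by apply: cvgZr_tmp; exact: dot_continuous.
have := continuous_measurable_real cf.
move=> /(_ measurableT [set 0] (measurable_set1 _)).
rewrite setTI; congr measurable; rewrite span_firstE; apply/seteqP.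
by split=> t /= => [/normr0_eq0/subr0_eq//|->]; rewrite subrr normr0.
Qed.

Section representer.
Variable ip : H -> H -> R.
Hypothesis ip_ip : inner_product_on (span_first e D) ip.

Lemma inner_product_on0l w : span_first e D w -> ip 0 w = 0.
Proof.
move=> Ew; have [_ lin _] := ip_ip.
have E0 : span_first e D 0.
  by exists (fun=> 0); rewrite big1// => i _; rewrite scale0r.
by have := lin 1 0 0 w E0 E0 Ew; rewrite scaler0 addr0 mul1r => h; lra.
Qed.

Lemma inner_product_on_suml (c : 'I_D -> R) w : span_first e D w ->
  ip (\sum_(i < D) c i *: e i) w = \sum_(i < D) c i * ip (e i) w.
Proof.
move=> Ew; have [_ lin _] := ip_ip.
have Esum (s : seq 'I_D) : span_first e D (\sum_(i <- s) c i *: e i).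
  elim: s => [|i s [a IH]].
    by exists (fun=> 0); rewrite big_nil big1// => i _; rewrite scale0r.
  have [b ei] := span_first_e i.
  exists (fun j => c i * b j + a j); rewrite big_cons IH {1}ei scaler_sumr.
  by rewrite -big_split/=; apply: eq_bigr => j _; rewrite scalerA -scalerDl.
elim: (index_enum _) => [|i s IH]; first by rewrite !big_nil inner_product_on0l.
by rewrite !big_cons lin ?IH//; exact: span_first_e.
Qed.

(** The Riesz representation on a finite-dimensional space, for the inner
    product [ip]: the coordinates of [h] solve a linear system whose Gram matrix
    [A] is invertible, since a row [v] with [v *m A = 0] gives a vector [u] with
    [ip u u = 0]. *)
Lemma representer_span_first (psi : H) :
  exists2 h, span_first e D h &
    forall t, span_first e D t -> hdot t psi = ip h t.
Proof.
have [sym lin pos] := ip_ip.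
pose A : 'M[R]_D := \matrix_(i, j) ip (e i) (e j).
have ipA (c : 'rV[R]_D) (j : 'I_D) :
    ip (\sum_(i < D) c 0 i *: e i) (e j) = (c *m A) 0 j.
  rewrite inner_product_on_suml ?mxE; last exact: span_first_e.
  by apply: eq_bigr => i _; rewrite mxE.
have ipAA (c : 'rV[R]_D) (a : 'I_D -> R) :
    ip (\sum_(i < D) c 0 i *: e i) (\sum_(j < D) a j *: e j) =
    \sum_(j < D) a j * (c *m A) 0 j.
  have Ec : span_first e D (\sum_(i < D) c 0 i *: e i) by exists (c 0).
  rewrite sym//; last by exists a.
  rewrite inner_product_on_suml//; apply: eq_bigr => j _; rewrite sym ?ipA//.
  exact: span_first_e.
have Aunit : A \in unitmx.
  rewrite -row_free_unit -kermx_eq0; apply/rowV0P => v /sub_kermxP vA.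
  have u0 : \sum_(i < D) v 0 i *: e i = 0.
    apply/eqP; apply/negP => /negP u0.
    have := pos _ (ex_intro _ (v 0) erefl) u0.
    by rewrite ipAA vA big1 ?ltxx// => j _; rewrite mxE mulr0.
  by apply/rowP => j; rewrite mxE -(dot_sum_first (v 0) j) u0 linear0l.
pose c := (\row_j hdot (e j) psi) *m invmx A.
exists (\sum_(i < D) c 0 i *: e i); first by exists (c 0).
move=> _ [a ->]; rewrite ipAA mulmxKV// linear_sumlz/=; apply: eq_bigr => j _.
by rewrite linearZl_LR/= mxE.
Qed.

End representer.
End dot.

Lemma continuous_affine_functionals (R : realType) (H : normedModType R)
    (hdot : {dot H for idfun}) (hdot_norm : norm_from_dot hdot)
    (k : nat) (psi : 'I_k -> H) (c : R) (A : 'M[R]_k) (b : 'cV[R]_k) :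
  continuous (fun t => c *: (A *m (functionals hdot psi t - b))).
Proof.
apply: continuous_mx => i j; rewrite ord1.
have -> : (fun t => (c *: (A *m (functionals hdot psi t - b))) i 0) =
    (fun t => c * \sum_l A i l * (hdot t (psi l) - b l 0)).
  apply/funext => t; rewrite !mxE; congr (_ * _).
  by apply: eq_bigr => l _; rewrite !mxE.
move=> t; apply: cvgM; first exact: cvg_cst.
apply: continuous_sum => l u; apply: cvgM; first exact: cvg_cst.
by apply: cvgB; [exact: dot_continuous|exact: cvg_cst].
Qed.

(** * Integrability under the prior and the posterior *)

(** On [E], which carries all the mass, [phi] is [ip h], whose law is a centered
    normal law unless [h = 0]. *)
Lemma gaussian_functional_integrable (R : realType) (H : normedModType R)
    (E : set H) (ip : H -> H -> R) (mu : probability (borel H) R) (h : H)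
    (phi : borel H -> R) :
  measurable (E : set (borel H)) -> E 0 -> inner_product_on E ip ->
  std_gaussian_on E ip mu -> measurable_fun setT phi ->
  E h -> (forall t, E t -> phi t = ip h t) ->
  mu.-integrable setT (EFin \o phi).
Proof.
move=> mE E0 [sym lin pos] [muE gauss] mphi Eh phiE.
apply/integrableP; split; first exact/measurable_EFinP.
have muC0 : mu (~` E) = 0%E.
  by rewrite probability_setC// [X in (_ - X)%E]muE subee.
have [h0|h0] := eqVneq h 0.
  rewrite (_ : (\int[mu]_x `|(EFin \o phi) x|)%E = (\int[mu]_x cst 0 x)%E).
    by rewrite integral0 ltry.
  apply: ae_eq_integral => //.
    by apply/measurable_EFinP; exact: measurableT_comp.
  exists (~` E); split => //; first exact: measurableC.
  move=> t /= tN Et; apply: tN => _.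
  rewrite phiE// h0; have := lin 1 0 0 t E0 E0 Et.
  rewrite scaler0 addr0 mul1r => ip0; have -> : ip 0 t = 0 by lra.
  by rewrite normr0.
apply: (@normal_law_abs_moment_lty _ _ _ mu phi (Num.sqrt (ip h h))) => //.
  by rewrite gt_eqF// sqrtr_gt0 pos.
move=> A mA; rewrite -gauss//.
have mphiA : measurable (phi @^-1` A).
  by rewrite -[X in measurable X]setTI; exact: mphi.
have -> : E `&` [set t | A (ip h t)] = E `&` phi @^-1` A.
  by apply/seteqP; split=> t [Et /=]; rewrite phiE.
rewrite setIC [LHS](measureDI _ mphiA mE).
rewrite [X in (X + _)%E](_ : _ = 0%E) ?add0e//.
apply/eqP; rewrite -measure_le0 -muC0 le_measure ?inE//.
- exact: measurableD.
- exact: measurableC.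
Qed.

(** As [expR ell <= 1], the density of the posterior with respect to the prior
    is at most the inverse of the normalizing constant. *)
Lemma posterior_integrable (R : realType) (H : normedModType R)
    (E : set H) (prior post : probability (borel H) R) (ell : H -> R)
    (phi : borel H -> R) :
  (forall t, ell t <= 0) -> is_posterior E prior ell post ->
  prior.-integrable setT (EFin \o phi) -> post.-integrable setT (EFin \o phi).
Proof.
move=> ell0 bayes /integrableP[mphi iphi]; apply/integrableP; split => //.
have c0 : 0 <= (fine (\int[prior]_(t in E) (expR (ell t))%:E)%E)^-1.
  by rewrite invr_ge0 fine_ge0// integral_ge0.
pose c := NngNum c0.
have post_le A : measurable A -> (post A <= mscale c prior A)%E.
  move=> mA; rewrite bayes// /mscale/= lee_wpmul2l ?lee_fin//.
  apply: (@le_trans _ _ (\int[prior]_(x in A) cst 1%E x)%E); last first.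
    by rewrite integral_cst// mul1e.
  rewrite [leLHS]integral_mkcond [leRHS]integral_mkcond.
  apply: ge0_le_integral_any => t _; rewrite !patchE.
    by case: ifP => // _; rewrite lee_fin expR_ge0.
  case: ifPn => [/set_mem[At _]|_].
    by rewrite mem_set// lee_fin -expR0 ler_expR.
  by case: ifP => // _; rewrite lee_fin.
apply: le_lt_trans (ge0_le_measure_integral post_le measurableT _ _) _ => //.
  by apply: measurableT_comp.
rewrite ge0_integral_mscale//; last exact: measurableT_comp.
by rewrite lte_mul_pinfty// lee_fin.
Qed.

Lemma log_likelihood_le0 (R : realType) d (V H : normedModType R)
    (G : H -> borel 'rV[R]_d -> borel V) N (x : nat -> borel 'rV[R]_d)
    (y : nat -> V) t : log_likelihood G N x y t <= 0.
Proof.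
rewrite /log_likelihood mulNr oppr_le0 mulr_ge0// ?divr_ge0//.
by apply: sumr_ge0 => i _; rewrite exprn_ge0.
Qed.

(** Linearity of the integral needs the coordinates to be integrable: [fine]
    sends an infinite expectation to [0]. *)
Lemma mean_vector_affine d (T : measurableType d) (R : realType)
    (Q : probability T R) k (Y : T -> 'cV[R]_k) (c : R) (A : 'M[R]_k)
    (b : 'cV[R]_k) :
  (forall j, Q.-integrable setT (fun t => (Y t j 0)%:E)) ->
  mean_vector Q (fun t => c *: (A *m (Y t - b))) =
  c *: (A *m (mean_vector Q Y - b)).
Proof.
move=> iY; apply/colP => j; rewrite !mxE unlock.
have iYb i : Q.-integrable setT (fun t => (Y t i 0 - b i 0)%:E).
  apply: (eq_integrable measurableT
    (fun t => (Y t i 0)%:E - (b i 0)%:E)%E) => //.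
  by apply: integrableB => //; exact: finite_measure_integrable_cst.
transitivity (fine
    (\int[Q]_t \sum_(i < k) (c * A j i)%:E * (Y t i 0 - b i 0)%:E)%E).
  congr fine; apply: eq_integral => t _; rewrite !mxE mulr_sumr -sumEFin.
  by apply: eq_bigr => i _; rewrite !mxE -EFinM mulrA.
rewrite integral_sum//; last by move=> i; exact: integrableZl.
rewrite mulr_sumr -sum_fine; last first.
  by move=> i _; apply: integrable_fin_num => //; exact: integrableZl.
apply: eq_bigr => i _; rewrite !mxE integralZl// fineM//; last first.
  exact: integrable_fin_num.
rewrite -mulrA unlock; congr (_ * (_ * _)) => /=.
rewrite -[LHS]/(\int[Q]_t (Y t i 0 - b i 0)).
rewrite RintegralB//; [|exact: iY|]; last first.
  exact: finite_measure_integrable_cst.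
by rewrite Rintegral_cst// [X in fine X]probability_setT mulr1.
Qed.

(** * Recentering at the posterior mean *)

Theorem theorem2p5 (R : realType)
  (* the domain and its uniform distribution *)
  (d : nat) (lam : {measure set (borel 'rV[R]_d) -> \bar R})
  (lebesgue_lam : is_lebesgue lam)
  (X : set (borel 'rV[R]_d)) (mX : measurable X)
  (X_gt0 : (0 < lam X)%E) (X_fin : (lam X < +oo)%E)
  (lamX : probability (borel 'rV[R]_d) R) (lamX_unif : is_uniform lam X lamX)
  (* the Hilbert space, its basis, and the parameter space *)
  (H : completeNormedModType R) (hdot : {dot H for idfun})
  (hdot_norm : norm_from_dot hdot)
  (e : nat -> H) (e_basis : orthonormal_basis hdot e)
  (Theta : set H) (Theta_lin : linear_subspace Theta)
  (Theta_span : forall D, span_first e D `<=` Theta)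
  (* the forward map *)
  (V : normedModType R) (vdot : {dot V for idfun})
  (vdot_norm : norm_from_dot vdot) (V_fin : finite_dimensional V)
  (G : H -> borel 'rV[R]_d -> borel V)
  (G_L2 : forall t, Theta t -> L2 X lamX (G t))
  (G_meas : L2_measurable X lamX Theta G)
  (G_joint : jointly_measurable X Theta G)
  (* the observations *)
  (theta0 : H) (theta0_in : Theta theta0)
  (dO : measure_display) (Omega : measurableType dO) (P : probability Omega R)
  (Xs : nat -> Omega -> borel 'rV[R]_d) (eps : nat -> Omega -> borel V)
  (mXs : forall i, measurable_fun setT (Xs i))
  (meps : forall i, measurable_fun setT (eps i))
  (Xs_in : forall i w, X (Xs i w))
  (Xs_law : forall i A, measurable A -> P (Xs i @^-1` A) = lamX A)
  (eps_law : forall i, std_gaussian_on setT vdot (pushforward P (eps i)))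
  (indep : mutually_independent P (joint_sigma Xs eps))
  (* the functionals of interest *)
  (k : nat) (psi : 'I_k -> H) (psi_free : linearly_independent psi)
  (* the linearization *)
  (L : H -> borel 'rV[R]_d -> borel V)
  (Ladj : (borel 'rV[R]_d -> borel V) -> H)
  (L_lin : bounded_linear_L2 X lamX L)
  (L_grad : gateaux_linearization X lamX Theta G theta0 L)
  (Ladj_adj : is_adjoint vdot X lamX hdot L Ladj)
  (info_inv : forall D, set_bij (span_first e D) (span_first e D)
     (info_op hdot e (fun h => Ladj (L h)) D))
  (* the priors and the posteriors *)
  (D : nat -> nat) (D_oo : D N @[N --> \oo] --> \oo)
  (ip : nat -> H -> H -> R)
  (ip_ip : forall N, inner_product_on (span_first e (D N)) (ip N))
  (prior : nat -> probability (borel H) R)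
  (prior_gauss : forall N,
     std_gaussian_on (span_first e (D N)) (ip N) (prior N))
  (post : nat -> Omega -> probability (borel H) R)
  (post_bayes : forall N w,
     is_posterior (span_first e (D N)) (prior N)
       (log_likelihood G N (fun i => Xs i w)
          (fun i => (G theta0 (Xs i w) : V) + eps i w))
       (post N w))
  (* the standard Gaussian measure of R^k *)
  (gauss : probability (borel 'cV[R]_k) R)
  (gauss_std : std_gaussian_on setT (@edot R k) gauss) :
  let info h := Ladj (L h) in
  let Psi := functionals hdot psi in
  let PsiN N w : 'cV[R]_k := Psi theta0 + \col_j (N%:R^-1 * \sum_(i < N)
        vdot (eps i w) (L (psi_bar hdot e info psi (D N) j) (Xs i w))) in
  let PsiHat N w : 'cV[R]_k := mean_vector (post N w) Psi in
  let rescale N (x : 'cV[R]_k) : 'cV[R]_k :=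
    Num.sqrt N%:R *: (mxsqrt (efficient_info hdot e info psi (D N)) *m x) in
  let Z N w (t : borel H) : borel 'cV[R]_k := rescale N (Psi t - PsiN N w) in
  cvg_in_distribution P (fun N w => rescale N (PsiN N w - Psi theta0)) gauss ->
  weak_cvg_in_probability P
    (fun N w => pushforward (post N w) (Z N w)) gauss ->
  cvg_in_probability P (fun N w => mean_vector (post N w) (Z N w)) 0 ->
  cvg_in_probability P (fun N w => covariance_mx (post N w) (Z N w)) 1%:M ->
  weak_cvg_in_probability P
    (fun N w => pushforward (post N w)
       (fun t => rescale N (Psi t - PsiHat N w) : borel 'cV[R]_k)) gauss /\
  cvg_in_distribution P (fun N w => rescale N (PsiHat N w - Psi theta0)) gauss.
Proof.
move=> info Psi PsiN PsiHat rescale Z asym weakZ meanZ _.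
have psi_int N w j :
    (post N w).-integrable setT (EFin \o (fun t => hdot t (psi j))).
  apply: (posterior_integrable _ (post_bayes N w)).
    by move=> t; exact: log_likelihood_le0.
  have [h Eh hE] := representer_span_first e_basis.1 (ip_ip N) (psi j).
  apply: (gaussian_functional_integrable _ _ (ip_ip N) (prior_gauss N) _ Eh hE).
  - exact: measurable_span_first hdot_norm _ e_basis.1 _.
  - by exists (fun=> 0); rewrite big1// => i _; rewrite scale0r.
  - apply: continuous_measurable_real; exact: (dot_continuous hdot_norm).
have meanE N w :
    mean_vector (post N w) (Z N w) = rescale N (PsiHat N w - PsiN N w).
  apply: mean_vector_affine => j.
  by apply: eq_integrable (psi_int N w j) => // t _ /=; rewrite mxE.
have mrescale N b : measurable_fun setT
    (fun t : borel H => rescale N (Psi t - b) : borel 'cV[R]_k).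
  apply: continuous_measurable_borel.
  exact: (continuous_affine_functionals hdot_norm).
have rescaleB N x y : rescale N x - rescale N y = rescale N (x - y).
  by rewrite /rescale -scalerBr -mulmxBr.
have posterior_shift N w t : rescale N (Psi t - PsiHat N w) =
    rescale N (Psi t - PsiN N w) - mean_vector (post N w) (Z N w).
  by rewrite meanE rescaleB opprB addrA subrK.
have estimator_shift N w : rescale N (PsiHat N w - Psi theta0) -
    rescale N (PsiN N w - Psi theta0) = mean_vector (post N w) (Z N w).
  by rewrite meanE rescaleB opprB addrA subrK.
split; last first.
  apply: slutsky asym _.
  rewrite (_ : (fun N w => _) = fun N w => mean_vector (post N w) (Z N w))//.
  by apply/funext => N; apply/funext => w; exact: estimator_shift.
apply: (@cvg_in_probability_le _ _ _ P _ _
    (fun N w => dBL (pushforward (post N w) (Z N w)) gauss)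
    (fun N w => mean_vector (post N w) (Z N w)) (Num.sqrt k%:R)) => // N w.
have mZ : measurable_fun setT (Z N w) := mrescale N (PsiN N w).
have mZhat := mrescale N (PsiHat N w).
rewrite dBL_ge0//=.
have E : (fun t => rescale N (Psi t - PsiHat N w) : borel 'cV[R]_k) =
    (fun t => (Z N w t : 'cV[R]_k) - mean_vector (post N w) (Z N w)).
  by apply/funext => t; exact: posterior_shift.
rewrite E in mZhat *.
exact: dBL_shift.
Qed.
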